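(* Let $\mathcal I\subset\mathrm{Int}(\mathbb R^d)$ be closed under thickenings. Then, for any $\mathbb R^d$-modules $M,N:\mathbb R^d\to\mathbf{vec}$, $$d_{\mathrm E}(\mathrm{rk}_M^{\mathcal I},\mathrm{rk}_N^{\mathcal I})\le d_{\mathrm I}(M,N).$$
   Context: Fix a field $k$; $\mathbf{vec}$ is the category of finite-dimensional $k$-vector spaces. $\mathbb R^d$ carries the product order and is regarded as a category. An $\mathbb R^d$-module is a functor $M:\mathbb R^d\to\mathbf{vec}$, with structure maps $\varphi_M(a,b):M(a)\to M(b)$ for $a\le b$. An interval of a poset $P$ is a nonempty $I\subset P$ that is convex ($p,r\in I$, $p\le q\le r$ imply $q\in I$) and connected (any two elements of $I$ are joined by a finite sequence in $I$ whose consecutive elements are comparable). $\mathrm{Int}(P)$ is the set of intervals of $P$. For a module $M$ and interval $I$, $\mathrm{rk}_M(I)$ is the rank of the canonical map $\varprojlim M|_I\to\varinjlim M|_I$ (given by $i_p\circ\pi_p$ for any $p\in I$, with $\pi_p,i_p$ the structure maps of limit and colimit), and $\mathrm{rk}_M^{\mathcal I}$ is the restriction of $\mathrm{rk}_M$ to $\mathcal I$. Interleaving distance: for $\epsilon\ge0$ let $\vec\epsilon=\epsilon(1,\dots,1)\in\mathbb R^d$. The shift $M^{\vec\epsilon}$ is $M^{\vec\epsilon}(a)=M(a+\vec\epsilon)$, $\varphi_{M^{\vec\epsilon}}(a,b)=\varphi_M(a+\vec\epsilon,b+\vec\epsilon)$; for a morphism $\alpha$, $\alpha(\vec\epsilon)_a=\alpha_{a+\vec\epsilon}$;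 $\varphi_M^{\vec\epsilon}:M\to M^{\vec\epsilon}$ is the morphism with components $\varphi_M(a,a+\vec\epsilon)$. $M,N$ are $\epsilon$-interleaved if there are morphisms $\alpha:M\to N^{\vec\epsilon}$, $\beta:N\to M^{\vec\epsilon}$ with $\beta(\vec\epsilon)\circ\alpha=\varphi_M^{2\vec\epsilon}$ and $\alpha(\vec\epsilon)\circ\beta=\varphi_N^{2\vec\epsilon}$. $d_{\mathrm I}(M,N)$ is the infimum of $\epsilon\ge0$ such that $M,N$ are $\epsilon$-interleaved ($\infty$ if none). Thickening: $I^\epsilon:=\{p\in\mathbb R^d:\exists q\in I,\ \|p-q\|_\infty\le\epsilon\}$. $\mathcal I$ is closed under thickenings if $I^\epsilon\in\mathcal I$ for all $I\in\mathcal I$, $\epsilon\ge0$. Erosion distance: there is an $\epsilon$-erosion between $\mathrm{rk}_M^{\mathcal I}$ and $\mathrm{rk}_N^{\mathcal I}$ if for all $I\in\mathcal I$, $\mathrm{rk}_M(I^\epsilon)\le\mathrm{rk}_N(I)$ and $\mathrm{rk}_N(I^\epsilon)\le\mathrm{rk}_M(I)$. $d_{\mathrm E}(\mathrm{rk}_M^{\mathcal I},\mathrm{rk}_N^{\mathcal I})$ is the infimum of $\epsilon\ge0$ for which an $\epsilon$-erosion exists ($\infty$ if none). *)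

(* Defs.v *)
From HB Require Import structures.
From mathcomp Require Import all_boot all_order all_algebra.
From mathcomp Require Import generic_quotient ring_quotient.
From mathcomp Require Import all_classical all_reals all_analysis.
Set Implicit Arguments.
Unset Strict Implicit.
Unset Printing Implicit Defensive.
Import Order.TTheory GRing.Theory Num.Theory.
Import numFieldNormedType.Exports.
Local Open Scope classical_set_scope.
Local Open Scope ring_scope.

Local Notation fext := functional_extensionality_dep.

Section ProductModule.
Variables (k : pzRingType) (T : Type) (V : T -> lmodType k).

Definition prodmod : Type := forall t, V t.
HB.instance Definition _ := Choice.copy prodmod (forall t, V t).

Definition prodmod_add (x y : prodmod) : prodmod := fun t => x t + y t.
Definition prodmod_opp (x : prodmod) : prodmod := fun t => - x t.
Definition prodmod_zero : prodmod := fun=> 0.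
Definition prodmod_scale (c : k) (x : prodmod) : prodmod := fun t => c *: x t.

Fact prodmod_addA : associative prodmod_add.
Proof. by move=> x y z; apply: fext => t; exact: addrA. Qed.
Fact prodmod_addC : commutative prodmod_add.
Proof. by move=> x y; apply: fext => t; exact: addrC. Qed.
Fact prodmod_add0 : left_id prodmod_zero prodmod_add.
Proof. by move=> x; apply: fext => t; exact: add0r. Qed.
Fact prodmod_addN : left_inverse prodmod_zero prodmod_opp prodmod_add.
Proof. by move=> x; apply: fext => t; exact: addNr. Qed.

HB.instance Definition _ := GRing.isZmodule.Build prodmod
  prodmod_addA prodmod_addC prodmod_add0 prodmod_addN.

Fact prodmod_scaleA a b (x : prodmod) :
  prodmod_scale a (prodmod_scale b x) = prodmod_scale (a * b) x.
Proof. by apply: fext => t; exact: scalerA. Qed.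
Fact prodmod_scale1 : left_id 1 prodmod_scale.
Proof. by move=> x; apply: fext => t; exact: scale1r. Qed.
Fact prodmod_scaleDr : right_distributive prodmod_scale +%R.
Proof. by move=> a x y; apply: fext => t; exact: scalerDr. Qed.
Fact prodmod_scaleDl (x : prodmod) : {morph prodmod_scale^~ x : a b / a + b}.
Proof. by move=> a b; apply: fext => t; exact: scalerDl.
Qed.

HB.instance Definition _ := GRing.Zmodule_isLmodule.Build k prodmod
  prodmod_scaleA prodmod_scale1 prodmod_scaleDr prodmod_scaleDl.

End ProductModule.

Section DirectSum.
Variables (k : pzRingType) (T : choiceType) (V : T -> lmodType k).

Definition finsupp_pred : {pred prodmod V} :=
  fun x => `[< finite_set [set t | x t != 0] >].

Fact finsupp_closed : submod_closed finsupp_pred.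
Proof.
split.
  apply/asboolP; apply: (@sub_finite_set _ _ set0) => // t /=.
  by rewrite eqxx.
move=> a x y /asboolP fx /asboolP fy; apply/asboolP.
apply: (@sub_finite_set _ _ ([set t | x t != 0] `|` [set t | y t != 0])).
  move=> t /=; have -> : (a *: x + y) t = a *: x t + y t by [].
  case: (eqVneq (x t) 0) => [->|]; last by left.
  by rewrite scaler0 add0r; right.
by rewrite finite_setU.
Qed.

HB.instance Definition _ :=
  GRing.isSubmodClosed.Build k (prodmod V) finsupp_pred
    (GRing.submod_closed_semi finsupp_closed).

Record dirsum : Type :=
  DirSum { dirsum_val :> prodmod V; _ : dirsum_val \in finsupp_pred }.
HB.instance Definition _ := [isSub for dirsum_val].
HB.instance Definition _ := [Choice of dirsum by <:].
HB.instance Definition _ := [SubChoice_isSubLmodule of dirsum by <:].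

Definition single (t : T) (v : V t) : prodmod V :=
  fun s => match t =P s with
           | ReflectT e => ecast s (V s) e v
           | ReflectF _ => 0
           end.

Lemma single_id t (v : V t) : single v t = v.
Proof.
rewrite /single; case: (t =P t) => // e.
by rewrite (eq_axiomK e).
Qed.

Lemma single_ne t s (v : V t) : t != s -> single v s = 0.
Proof. by rewrite /single; case: (t =P s). Qed.

Fact single_finsupp t (v : V t) : single v \in finsupp_pred.
Proof.
apply/asboolP; apply: (@sub_finite_set _ _ [set t]); last exact: finite_set1.
move=> s /=; case: (eqVneq t s) => [//|ne].
by rewrite single_ne ?eqxx.
Qed.

Definition dirsum_in (t : T) (v : V t) : dirsum := DirSum (single_finsupp v).

Fact dirsum_in_linear t : linear (@dirsum_in t).
Proof.
move=> a u v; apply/val_inj; apply: fext => s.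
change (single (a *: u + v) s = a *: single u s + single v s).
case: (eqVneq t s) => [e|ne]; last by rewrite !single_ne // scaler0 addr0.
by case: s / e; rewrite !single_id.
Qed.
HB.instance Definition _ t :=
  GRing.isLinear.Build k (V t) dirsum *:%R (@dirsum_in t) (@dirsum_in_linear t).

Fact dirsum_ev_linear t : linear (fun z : dirsum => dirsum_val z t).
Proof. by []. Qed.

Lemma dirsum_suppP (z : dirsum) :
  exists2 r : seq T, uniq r & forall t, t \notin r -> dirsum_val z t = 0.
Proof.
case: z => z /= /asboolP /finite_seqP[r rE].
exists (undup r) => [|t]; first exact: undup_uniq.
rewrite mem_undup => tr; apply: contrapT => /eqP zt; move/negP: tr; apply.
have : [set t | z t != 0] t by [].
by rewrite rE.
Qed.

Lemma dirsum_decomp (z : dirsum) :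
  exists r : seq T, z = \sum_(t <- r) dirsum_in (dirsum_val z t).
Proof.
have [r ur rP] := dirsum_suppP z; exists r.
apply/val_inj; apply: fext => s.
pose ev := GRing.isLinear.Build k dirsum (V s) *:%R _ (dirsum_ev_linear s).
pose evL := HB.pack_for {linear dirsum -> V s}
  (fun z : dirsum => dirsum_val z s) ev.
change (evL z = evL (\sum_(t <- r) dirsum_in (dirsum_val z t))).
rewrite linear_sum.
change (dirsum_val z s = \sum_(t <- r) single (dirsum_val z t) s).
case: (boolP (s \in r)) => sr.
  rewrite (bigD1_seq s) //= single_id big1 ?addr0 // => t ts.
  exact: single_ne.
rewrite rP // big_seq big1 // => t tr; apply: single_ne.
by apply: contraNneq sr => <-.
Qed.

Lemma dirsum_universal (W : lmodType k) (f : forall t, {linear V t -> W}) :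
  exists g : {linear dirsum -> W}, forall t v, g (@dirsum_in t v) = f t v.
Proof.
pose g (z : dirsum) : W := \sum_(t \in [set: T]) f t (dirsum_val z t).
have gE (z : dirsum) r :
    uniq r -> (forall t, t \notin r -> dirsum_val z t = 0) ->
    g z = \sum_(t <- r) f t (dirsum_val z t).
  move=> ur rP; rewrite /g (fsbigE r) //; last first.
    by move=> t _ /rP ->; rewrite linear0.
  by apply: eq_bigl => t; exact: mem_set.
have glin : linear g.
  move=> a x y; have [r _ rP] := dirsum_suppP x.
  have [s _ sP] := dirsum_suppP y.
  have xP t : t \notin undup (r ++ s) -> dirsum_val x t = 0.
    by rewrite mem_undup mem_cat negb_or => /andP[/rP].
  have yP t : t \notin undup (r ++ s) -> dirsum_val y t = 0.
    by rewrite mem_undup mem_cat negb_or => /andP[_ /sP].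
  have xyP t : t \notin undup (r ++ s) -> dirsum_val (a *: x + y) t = 0.
    move=> ts; change (a *: dirsum_val x t + dirsum_val y t = 0).
    by rewrite xP // yP // scaler0 addr0.
  rewrite !(gE _ (undup (r ++ s))) ?undup_uniq // scaler_sumr -big_split /=.
  apply: eq_bigr => t _.
  exact: (linearP (f t)).
pose gL := GRing.isLinear.Build k dirsum W *:%R g glin.
exists (HB.pack_for {linear dirsum -> W} g gL) => t v.
change (g (dirsum_in v) = f t v).
rewrite (gE _ [:: t]) //= ?big_seq1 ?single_id // => s.
by rewrite inE => st; apply: single_ne; rewrite eq_sym.
Qed.

End DirectSum.

Section QuotientModule.
Variables (k : pzRingType) (V : lmodType k) (S : {pred V}).

Definition submod_pred (hS : submod_closed S) : {pred V} := S.
HB.instance Definition _ (hS : submod_closed S) :=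
  GRing.isSubmodClosed.Build k V (submod_pred hS)
    (GRing.submod_closed_semi hS).

Variable hS : submod_closed S.
Local Notation W := (submod_pred hS).

Definition quotmod : Type := Quotient.quot W.
HB.instance Definition _ := GRing.Zmodule.on quotmod.

Definition quot_pi (x : V) : quotmod := (\pi_(Quotient.quot W) x)%qT.
Definition quot_scale (a : k) (x : quotmod) : quotmod :=
  quot_pi (a *: repr (x : Quotient.quot W)).

Lemma quot_piK (x : quotmod) : quot_pi (repr (x : Quotient.quot W)) = x.
Proof. exact: reprK. Qed.

Lemma quot_piE x y : (quot_pi x = quot_pi y) <-> (x - y \in S).
Proof.
change (x - y \in S) with (x - y \in W).
by rewrite Quotient.idealrBE; split=> [/eqP|/eqP].
Qed.

Lemma quot_piD x y : quot_pi (x + y) = quot_pi x + quot_pi y.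
Proof. exact: Quotient.pi_add. Qed.

Fact quot_piZ a x : quot_pi (a *: x) = quot_scale a (quot_pi x).
Proof.
apply/quot_piE; rewrite -scalerBr.
change (a *: (x - repr (quot_pi x : Quotient.quot W)) \in W).
by apply: rpredZ; apply/quot_piE; rewrite quot_piK.
Qed.

Fact quot_scaleA a b x : quot_scale a (quot_scale b x) = quot_scale (a * b) x.
Proof. by rewrite -(quot_piK x) -!quot_piZ scalerA. Qed.
Fact quot_scale1 : left_id 1 quot_scale.
Proof. by move=> x; rewrite -(quot_piK x) -!quot_piZ scale1r. Qed.
Fact quot_scaleDr : right_distributive quot_scale +%R.
Proof.
move=> a x y; rewrite -(quot_piK x) -(quot_piK y) -quot_piD -!quot_piZ.
by rewrite -quot_piD scalerDr.
Qed.
Fact quot_scaleDl x : {morph quot_scale^~ x : a b / a + b}.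
Proof.
by move=> a b; rewrite -(quot_piK x) -!quot_piZ -quot_piD scalerDl.
Qed.

HB.instance Definition _ := GRing.Zmodule_isLmodule.Build k quotmod
  quot_scaleA quot_scale1 quot_scaleDr quot_scaleDl.

Fact quot_pi_linear : linear quot_pi.
Proof. by move=> a x y; rewrite quot_piD quot_piZ. Qed.
HB.instance Definition _ :=
  GRing.isLinear.Build k V quotmod *:%R quot_pi quot_pi_linear.

End QuotientModule.

Section Rank.
Variable k : fieldType.

(* b is a basis of the image of f, which may have infinite-dimensional domain
   and codomain. *)
Definition has_rank (U W : lmodType k) (f : U -> W) (r : nat) : Prop :=
  exists b : 'I_r -> W,
    [/\ forall i, exists u, f u = b i,
        forall c : 'I_r -> k, \sum_i c i *: b i = 0 -> forall i, c i = 0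
      & forall u, exists c : 'I_r -> k, f u = \sum_i c i *: b i].

Lemma has_rank_le (U W : lmodType k) (f : U -> W) r s :
  has_rank f r -> has_rank f s -> (r <= s)%N.
Proof.
move=> [b [bim bfree _]] [b' [_ _ b'span]].
have Cex i : exists c : 'I_s -> k, b i = \sum_j c j *: b' j.
  by have [u <-] := bim i; exact: b'span.
have [C CE] := choice Cex.
pose A : 'M[k]_(r, s) := \matrix_(i, j) C i j.
suff : row_free A by move/eqP <-; exact: rank_leq_col.
rewrite -kermx_eq0; apply/rowV0P => v /sub_kermxP vA.
apply/rowP => i; rewrite mxE.
apply: (bfree (fun i => v 0 i)) i.
under eq_bigr => i _ do rewrite CE scaler_sumr.
rewrite exchange_big /=; apply: big1 => j _.
under eq_bigr => i _ do rewrite scalerA.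
rewrite -scaler_suml.
have := congr1 (fun w : 'rV_s => w 0 j) vA.
rewrite !mxE => e; rewrite -[X in X *: _](_ : 0 = _) ?scale0r //.
by rewrite -[LHS]e; apply: eq_bigr => i _; rewrite mxE.
Qed.

Lemma has_rank_uniq (U W : lmodType k) (f : U -> W) r s :
  has_rank f r -> has_rank f s -> r = s.
Proof.
by move=> hr hs; apply/eqP; rewrite eqn_leq !(has_rank_le hr, has_rank_le hs).
Qed.

Lemma has_rank_factor (U W : lmodType k) (X : vectType k)
    (g : {linear U -> X}) (h : {linear X -> W}) :
  exists r, has_rank (h \o g) r.
Proof.
pose P n := `[< exists b : 'I_n -> U, forall c : 'I_n -> k,
  \sum_i c i *: h (g (b i)) = 0 -> forall i, c i = 0 >].
have P0 : exists n, P n.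
  by exists 0%N; apply/asboolP; exists (fun=> 0) => c _ [].
have Pb n : P n -> (n <= \dim {:X})%N.
  move=> /asboolP[b bfree].
  pose t := [tuple g (b i) | i < n].
  have tfree : free t.
    apply/freeP => c c0; apply: bfree.
    have := congr1 h c0; rewrite linear0 linear_sum; apply: etrans.
    by apply: eq_bigr => i _; rewrite -tnth_nth tnth_mktuple linearZ.
  have := dimvS (subvf <<t>>%VS).
  by move/eqP: tfree => ->; rewrite size_tuple.
case: (ex_maxnP P0 Pb) => r /asboolP[b bfree] rmax.
exists r, (fun i => h (g (b i))); split=> // [i|u]; first by exists (b i).
apply: contrapT => nspan.
suff /rmax : P r.+1 by rewrite ltnn.
apply/asboolP; exists (fun i => oapp b u (unlift ord0 i)) => c.
rewrite big_ord_recl unlift_none /=.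
under eq_bigr => i _ do rewrite liftK /=.
case: (eqVneq (c ord0) 0) => [c0|c0].
  rewrite c0 scale0r add0r => /bfree cl i.
  by case: (unliftP ord0 i) => [j|] ->.
move=> e; exfalso; apply: nspan.
exists (fun i => - ((c ord0)^-1 * c (lift ord0 i))).
apply: (scalerI c0); rewrite scaler_sumr /=.
move/eqP: e; rewrite addr_eq0 => /eqP ->; rewrite -sumrN.
by apply: eq_bigr => i _; rewrite scalerA mulrN mulrA divff // mul1r scaleNr.
Qed.

End Rank.

Section Modules.
Variables (k : fieldType) (R : realType) (d : nat).
Local Notation Rd := 'rV[R]_d.

Definition vle (a b : Rd) : bool := [forall i, a 0 i <= b 0 i].

Lemma vleP (a b : Rd) : reflect (forall i, a 0 i <= b 0 i) (vle a b).
Proof. exact: forallP. Qed.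

Lemma vle_refl (a : Rd) : vle a a.
Proof. exact/vleP. Qed.

Lemma vle_trans (a b c : Rd) : vle a b -> vle b c -> vle a c.
Proof.
by move=> /vleP ab /vleP bc; apply/vleP => i; exact: le_trans (ab i) (bc i).
Qed.

Lemma vle_add2r (u a b : Rd) : vle a b -> vle (a + u) (b + u).
Proof. by move=> /vleP ab; apply/vleP => i; rewrite !mxE lerD2r. Qed.

Lemma vle_addr (u a : Rd) : vle 0 u -> vle a (a + u).
Proof.
by move=> /vleP u0; apply/vleP => i; have := u0 i; rewrite !mxE lerDl.
Qed.

Record pmodule := PModule {
  pm_obj :> Rd -> vectType k;
  pm_map : forall a b, vle a b -> 'Hom(pm_obj a, pm_obj b);
  pm_map_id : forall a, pm_map (vle_refl a) = \1%VF;
  pm_map_comp : forall a b c (ab : vle a b) (bc : vle b c),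
    pm_map (vle_trans ab bc) = (pm_map bc \o pm_map ab)%VF }.

Record pmorphism (M N : pmodule) := PMorphism {
  pmor :> forall a, 'Hom(M a, N a);
  pmor_natural : forall a b (ab : vle a b),
    (pm_map N ab \o pmor a)%VF = (pmor b \o pm_map M ab)%VF }.

Definition vcomparable (a b : Rd) : bool := vle a b || vle b a.

Definition vinterval (I : set Rd) : Prop :=
  [/\ I !=set0,
      forall p q r, I p -> I r -> vle p q -> vle q r -> I q
    & forall p q, I p -> I q -> exists s : seq Rd,
        [/\ path vcomparable p s, last p s = q & forall x, x \in s -> I x]].

Section Rank_invariant.
Variables (M : pmodule) (I : set Rd).

Local Notation fam := (fun p : I => M (val p) : lmodType k).

(* The limit of M|_I: the compatible families in the product of the M p. *)
Definition compat_pred : {pred prodmod fam} := fun x =>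
  `[< forall (p q : I) (pq : vle (val p) (val q)), pm_map M pq (x p) = x q >].

Fact compat_closed : submod_closed compat_pred.
Proof.
split; first by apply/asboolP => p q pq; rewrite linear0.
move=> a x y /asboolP cx /asboolP cy; apply/asboolP => p q pq.
change (pm_map M pq (a *: x p + y p) = a *: x q + y q).
by rewrite -(cx p q pq) -(cy p q pq); exact: linearP.
Qed.

HB.instance Definition _ :=
  GRing.isSubmodClosed.Build k (prodmod fam) compat_pred
    (GRing.submod_closed_semi compat_closed).

Record plim : Type :=
  PLim { plim_val :> prodmod fam; _ : plim_val \in compat_pred }.
HB.instance Definition _ := [isSub for plim_val].
HB.instance Definition _ := [Choice of plim by <:].
HB.instance Definition _ := [SubChoice_isSubLmodule of plim by <:].

Definition lim_proj (p : I) (x : plim) : M (val p) := plim_val x p.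

Fact lim_proj_linear p : linear (lim_proj p).
Proof. by []. Qed.
HB.instance Definition _ p :=
  GRing.isLinear.Build k plim (M (val p)) *:%R (lim_proj p) (lim_proj_linear p).

Lemma lim_projE (p q : I) (pq : vle (val p) (val q)) (x : plim) :
  pm_map M pq (lim_proj p x) = lim_proj q x.
Proof. by case: x => x /= /asboolP; exact. Qed.

Lemma lim_ext (x y : plim) : (forall p, lim_proj p x = lim_proj p y) -> x = y.
Proof. by move=> xy; apply/val_inj; exact: fext. Qed.

Lemma lim_universal (L : lmodType k)
    (f : forall p : I, {linear L -> M (val p)}) :
  (forall (p q : I) (pq : vle (val p) (val q)) x,
     pm_map M pq (f p x) = f q x) ->
  exists g : {linear L -> plim}, forall p x, lim_proj p (g x) = f p x.
Proof.
move=> fcompat.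
have gP x : (fun p => f p x : fam p) \in compat_pred by exact/asboolP.
pose g x := PLim (gP x).
have glin : linear g.
  by move=> a x y; apply: lim_ext => p; rewrite linearP; exact: linearP.
pose gL := GRing.isLinear.Build k L plim *:%R g glin.
by exists (HB.pack_for {linear L -> plim} g gL).
Qed.

(* The colimit of M|_I: the direct sum of the M p, modulo the submodule
   generated by the differences between x in M p and its image in M q. *)
Definition colim_rel : {pred dirsum fam} := fun z =>
  `[< forall S : {pred dirsum fam}, submod_closed S ->
      (forall (p q : I) (pq : vle (val p) (val q)) (x : fam p),
         dirsum_in x - dirsum_in (pm_map M pq x : fam q) \in S) ->
      z \in S >].

Fact colim_rel_closed : submod_closed colim_rel.
Proof.
split; first by apply/asboolP => S [].
move=> a x y /asboolP xP /asboolP yP; apply/asboolP => S hS gS.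
by case: (hS) => _; apply; [exact: xP|exact: yP].
Qed.

Definition pcolim : Type := quotmod colim_rel_closed.
HB.instance Definition _ := GRing.Lmodule.on pcolim.

Definition colim_in (p : I) (x : M (val p)) : pcolim :=
  quot_pi colim_rel_closed (dirsum_in (x : fam p)).

Fact colim_in_linear p : linear (@colim_in p).
Proof. by move=> a x y; rewrite /colim_in !linearP. Qed.
HB.instance Definition _ p :=
  GRing.isLinear.Build k (M (val p)) pcolim *:%R (@colim_in p)
    (@colim_in_linear p).

Lemma colim_inE (p q : I) (pq : vle (val p) (val q)) (x : M (val p)) :
  colim_in (pm_map M pq x) = colim_in x.
Proof. by apply/esym/quot_piE/asboolP => S _; exact. Qed.

Lemma colim_ext (W : lmodType k) (f g : {linear pcolim -> W}) :
  (forall p (x : M (val p)), f (colim_in x) = g (colim_in x)) -> f =1 g.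
Proof.
move=> fg z; rewrite -(quot_piK z).
have [r ->] := dirsum_decomp (repr (z : Quotient.quot _)).
by rewrite linear_sum !linear_sum; apply: eq_bigr => p _; exact: fg.
Qed.

Lemma colim_universal (W : lmodType k)
    (f : forall p : I, {linear M (val p) -> W}) :
  (forall (p q : I) (pq : vle (val p) (val q)) x,
     f q (pm_map M pq x) = f p x) ->
  exists g : {linear pcolim -> W},
    forall p (x : M (val p)), g (colim_in x) = f p x.
Proof.
move=> fcompat; have [g0 g0E] := @dirsum_universal k I fam W f.
have g0ker z : z \in colim_rel -> g0 z = 0.
  move=> /asboolP zP; apply/eqP; apply: (zP [pred z | g0 z == 0]).
    split; first by rewrite inE linear0.
    move=> a x y; rewrite !inE => /eqP gx /eqP gy.
    by rewrite linearP gx gy scaler0 addr0.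
  by move=> p q pq x; rewrite inE linearB !g0E fcompat subrr.
have g0pi x y :
    quot_pi colim_rel_closed x = quot_pi colim_rel_closed y -> g0 x = g0 y.
  by move=> /quot_piE/g0ker/eqP; rewrite linearB subr_eq0 => /eqP.
pose g (z : pcolim) :=
  g0 (repr (z : Quotient.quot (submod_pred colim_rel_closed))).
have gE x : g (quot_pi colim_rel_closed x) = g0 x.
  by apply: g0pi; exact: quot_piK.
have glin : linear g.
  move=> a x y; rewrite -(quot_piK x) -(quot_piK y) -linearP !gE.
  exact: linearP.
pose gL := GRing.isLinear.Build k pcolim W *:%R g glin.
exists (HB.pack_for {linear pcolim -> W} g gL) => p x.
by change (g (colim_in x) = f p x); rewrite gE g0E.
Qed.

Definition canonical_map (p : I) (x : plim) : pcolim := colim_in (lim_proj p x).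

Lemma canonical_map_indep (p q : I) :
  vinterval I -> canonical_map p =1 canonical_map q.
Proof.
case=> _ _ Iconn x.
have step (a b : I) :
    vle (val a) (val b) -> canonical_map a x = canonical_map b x.
  by move=> ab; rewrite /canonical_map -(lim_projE ab) colim_inE.
have [s [spath slast sI]] := Iconn _ _ (set_mem (valP p)) (set_mem (valP q)).
elim: s p spath slast sI => [|a s IH] p /=.
  by move=> _ pq _; congr canonical_map; exact: val_inj.
move=> /andP[pa spath] slast sI.
have aI : a \in I by apply: mem_set; apply: sI; rewrite inE eqxx.
pose a' : I := exist _ a aI.
rewrite -(IH a') //; last by move=> y ys; apply: sI; rewrite inE ys orbT.
by case/orP: pa => [/(step p a')|/(step a' p)] ->.
Qed.

(* The rank of the canonical map, at any p in I; for an interval there is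
   exactly one such r, whatever p is: see [rkP]. *)
Definition rk : nat :=
  xget 0%N [set r | exists p : I, has_rank (canonical_map p) r].

Lemma rkP : vinterval I -> forall p : I, has_rank (canonical_map p) rk.
Proof.
move=> iI p; rewrite /rk; case: xgetP => [r _ [q hq]|no].
  by rewrite (_ : canonical_map p = canonical_map q) //;
     apply/funext; exact: canonical_map_indep.
have [r hr] := has_rank_factor (lim_proj p) (@colim_in p).
by case: (no r); exists p.
Qed.

End Rank_invariant.

Definition epsvec (e : R) : Rd := const_mx e.

Lemma vle_epsvec (e : {nonneg R}) : vle 0 (epsvec e%:num).
Proof. by apply/vleP => i; rewrite !mxE. Qed.

Section Shift.
Variables (M : pmodule) (u : Rd).

Fact shift_map_id a : pm_map M (vle_add2r u (vle_refl a)) = \1%VF.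
Proof. by rewrite -pm_map_id; congr pm_map; exact: bool_irrelevance. Qed.

Fact shift_map_comp a b c (ab : vle a b) (bc : vle b c) :
  pm_map M (vle_add2r u (vle_trans ab bc)) =
  (pm_map M (vle_add2r u bc) \o pm_map M (vle_add2r u ab))%VF.
Proof. by rewrite -pm_map_comp; congr pm_map; exact: bool_irrelevance. Qed.

Definition pm_shift : pmodule :=
  @PModule (fun a => M (a + u)) (fun a b ab => pm_map M (vle_add2r u ab))
    shift_map_id shift_map_comp.

End Shift.

Lemma pm_map_square (M : pmodule) a b c e (ab : vle a b) (be : vle b e)
    (ac : vle a c) (ce : vle c e) :
  (pm_map M be \o pm_map M ab)%VF = (pm_map M ce \o pm_map M ac)%VF.
Proof. by rewrite -!pm_map_comp; congr pm_map; exact: bool_irrelevance. Qed.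

Definition shift_mor (M N : pmodule) (f : pmorphism M N) (u : Rd) :
    pmorphism (pm_shift M u) (pm_shift N u) :=
  @PMorphism (pm_shift M u) (pm_shift N u) (fun a => f (a + u))
    (fun a b ab => pmor_natural f (vle_add2r u ab)).

Fact comp_mor_natural (M N P : pmodule) (g : pmorphism N P) (f : pmorphism M N)
    a b (ab : vle a b) :
  (pm_map P ab \o (g a \o f a))%VF = ((g b \o f b) \o pm_map M ab)%VF.
Proof.
by rewrite comp_lfunA (pmor_natural g) -comp_lfunA (pmor_natural f) comp_lfunA.
Qed.

Definition comp_mor (M N P : pmodule) (g : pmorphism N P) (f : pmorphism M N) :
    pmorphism M P :=
  PMorphism (comp_mor_natural g f).

Definition unit_mor (M : pmodule) (u : Rd) (u0 : vle 0 u) :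
    pmorphism M (pm_shift M u) :=
  @PMorphism M (pm_shift M u) (fun a => pm_map M (vle_addr a u0))
    (fun a b ab => @pm_map_square M _ _ _ _ _ _ _ _).

Fact vle0_mul2n (u : Rd) : vle 0 u -> vle 0 (u *+ 2).
Proof.
move=> /vleP u0; apply/vleP => i; have := u0 i; rewrite mulr2n !mxE => h.
exact: addr_ge0.
Qed.

Fact vle_shift2 (a u : Rd) : vle (a + u + u) (a + u *+ 2).
Proof. by rewrite mulr2n addrA vle_refl. Qed.

(* The identification of (M^u)^u with M^(2u): the points a + u + u and a + 2u
   are equal but not convertible, so it is written as a structure map of M. *)
Definition shift2_mor (M : pmodule) (u : Rd) :
    pmorphism (pm_shift (pm_shift M u) u) (pm_shift M (u *+ 2)) :=
  @PMorphism (pm_shift (pm_shift M u) u) (pm_shift M (u *+ 2))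
    (fun a => pm_map M (vle_shift2 a u))
    (fun a b ab => @pm_map_square M _ _ _ _ _ _ _ _).

Definition interleaved (M N : pmodule) (e : {nonneg R}) : Prop :=
  let u := epsvec e%:num in
  let u2 := vle0_mul2n (vle_epsvec e) in
  exists (f : pmorphism M (pm_shift N u)) (g : pmorphism N (pm_shift M u)),
    (forall a, comp_mor (shift2_mor M u) (comp_mor (shift_mor g u) f) a
               = unit_mor M u2 a) /\
    (forall a, comp_mor (shift2_mor N u) (comp_mor (shift_mor f u) g) a
               = unit_mor N u2 a).

Definition dI (M N : pmodule) : \bar R :=
  ereal_inf [set e%:num%:E | e in [set e : {nonneg R} | interleaved M N e]].

(* The norm of 'rV[R]_d is the maximum norm. *)
Definition thicken (I : set Rd) (e : {nonneg R}) : set Rd :=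
  [set p | exists2 q, I q & `|p - q| <= e%:num].

Definition thickening_closed (J : set (set Rd)) : Prop :=
  forall I e, J I -> J (thicken I e).

Definition erosion (J : set (set Rd)) (r s : set Rd -> nat)
    (e : {nonneg R}) : Prop :=
  forall I, J I -> (r (thicken I e) <= s I)%N /\ (s (thicken I e) <= r I)%N.

Definition dE (J : set (set Rd)) (r s : set Rd -> nat) : \bar R :=
  ereal_inf [set e%:num%:E | e in [set e : {nonneg R} | erosion J r s e]].

End Modules.

(* Main.v *)
Require Import Defs.
From mathcomp Require Import all_boot all_order all_algebra.
From mathcomp Require Import all_classical all_reals all_analysis.
Set Implicit Arguments.
Unset Strict Implicit.
Unset Printing Implicit Defensive.
Import Order.TTheory GRing.Theory Num.Theory.
Local Open Scope classical_set_scope.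
Local Open Scope ring_scope.

(** Let [M] and [N] be [e]-interleaved through [f] and [g], and let [u] be the
    vector with all entries [e]. The points [p - u] and [p + u] lie in the
    thickening of [I] for every [p] in [I], so [f] induces a map from the limit
    of [M] on the thickening to the limit of [N] on [I], and [g] induces a map
    from the colimit of [N] on [I] to the colimit of [M] on the thickening.
    Composing them around the canonical map of [N] on [I] gives the canonical
    map of [M] on the thickening, which has therefore the smaller rank. *)

(** Each basis vector of the image of [h] is a combination of the [s] vectors [psi (b' j)]. The
    resulting coordinate rows in [k^s] are free, so there are at most [s] of them. *)
Lemma has_rank_comp_le (k : fieldType) (U V W X : lmodType k)
    (h : U -> W) (h' : V -> X) (phi : U -> V) (psi : {linear X -> W}) r s :
  (forall x, h x = psi (h' (phi x))) -> has_rank h r -> has_rank h' s ->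
  (r <= s)%N.
Proof.
move=> hE [b [bim bfree _]] [b' [_ _ b'span]].
have /choice[C CE] i : exists c : 'rV[k]_s, b i = \sum_j c 0 j *: psi (b' j).
  have [x <-] := bim i; have [c cE] := b'span (phi x).
  exists (\row_j c j); rewrite hE cE linear_sum.
  by apply: eq_bigr => j _; rewrite mxE linearZ.
(* By [CE], a linear relation between the rows [C i] carries over to the [b i], hence is trivial. *)
have Cfree : free [tuple C i | i < r].
  apply/freeP => c; under eq_bigr do rewrite -tnth_nth tnth_mktuple.
  move=> c0; apply: bfree.
  under eq_bigr do rewrite CE scaler_sumr.
  rewrite exchange_big /=; apply: big1 => j _.
  under eq_bigr do rewrite scalerA.
  rewrite -scaler_suml [X in X *: _](_ : _ = 0) ?scale0r //.
  have /rowP/(_ j) := c0; rewrite summxE mxE; apply: etrans.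
  by apply: eq_bigr => i _; rewrite mxE.
have := dimvS (subvf <<[tuple C i | i < r]>>%VS).
by rewrite (eqP Cfree) size_tuple dimvf /dim /= mul1n.
Qed.

Section Thickening.
Variables (R : realType) (d : nat) (I : set 'rV[R]_d) (e : {nonneg R}).
Local Notation u := (epsvec d e%:num).

(** Only an inequality, since the norm vanishes for [d = 0]. *)
Lemma norm_epsvec_le : `|u| <= e%:num.
Proof.
by rewrite /Num.Def.normr /= mx_normrE bigmax_le // => i _;
  rewrite mxE ger0_norm.
Qed.

Lemma thickenD p : I p -> thicken I e (p + u).
Proof. by move=> Ip; exists p => //; rewrite addrC addKr norm_epsvec_le. Qed.

Lemma thickenB p : I p -> thicken I e (p - u).
Proof.
by move=> Ip; exists p => //; rewrite addrC addKr normrN norm_epsvec_le.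
Qed.

End Thickening.

Section Erosion.
Variables (k : fieldType) (R : realType) (d : nat).
Implicit Types (M N : pmodule k R d) (I : set 'rV[R]_d) (e : {nonneg R}).

Lemma pm_map_compE M a b c (ab : vle a b) (bc : vle b c)
    (ac : vle a c) x :
  pm_map M bc (pm_map M ab x) = pm_map M ac x.
Proof.
by rewrite -comp_lfunE -pm_map_comp; congr (pm_map M _ x);
  exact: bool_irrelevance.
Qed.

Lemma pmor_naturalE M N (f : pmorphism M N) a b (ab : vle a b) x :
  f b (pm_map M ab x) = pm_map N ab (f a x).
Proof. by rewrite -!comp_lfunE pmor_natural. Qed.

Lemma interleaved_sym M N e : interleaved M N e -> interleaved N M e.
Proof. by move=> [f [g [fg gf]]]; exists g, f. Qed.

(* [p - u + u] and [p] are not convertible: structure maps along this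
   inequality transport between the two fibres. *)
Lemma vle_subK (p u : 'rV[R]_d) : vle (p - u + u) p.
Proof. by rewrite subrK vle_refl. Qed.

(** The interleaving identity is read at [p - u], after naturality of [g] has moved the transport
    along [vle_subK] to the outside, into [M]. *)
Lemma interleaving_round_trip M N e
    (f : pmorphism M (pm_shift N (epsvec d e%:num)))
    (g : pmorphism N (pm_shift M (epsvec d e%:num))) (u := epsvec d e%:num) :
  (forall a, comp_mor (shift2_mor M u) (comp_mor (shift_mor g u) f) a
             = unit_mor M (vle0_mul2n (vle_epsvec d e)) a) ->
  forall p (le_pu : vle (p - u) (p + u)) x,
    g p (pm_map N (vle_subK p u) (f (p - u) x)) = pm_map M le_pu x.
Proof.
move=> fg p le_pu x; rewrite pmor_naturalE /=.
have le2 : vle (p - u + u *+ 2) (p + u) by rewrite mulr2n addrA subrK vle_refl.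
(* Factoring through [p - u + u *+ 2] exposes the component of [shift2_mor] that occurs in [fg]. *)
rewrite -(pm_map_compE (vle_shift2 (p - u) u) le2).
have := congr1 (fun h : 'Hom(_, _) => h x) (fg (p - u)).
rewrite /= !comp_lfunE => ->; exact: pm_map_compE.
Qed.

Lemma rk_thicken_le M N e I : interleaved M N e ->
  vinterval I -> vinterval (thicken I e) -> (rk M (thicken I e) <= rk N I)%N.
Proof.
set u := epsvec d e%:num; move=> [f [g [fg _]]] iI iT.
have Ival (p : I) : I (val p) by exact/set_mem/valP.
pose up (p : I) : thicken I e := SigSub (mem_set (thickenD e (Ival p))).
pose dn (p : I) : thicken I e := SigSub (mem_set (thickenB e (Ival p))).
(* [f] at [p - u] lands in the fibre of [N] at [p - u + u], whence the transport to [p]. *)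
pose fdn (p : I) : 'Hom(M (val (dn p)), N (val p)) :=
  (pm_map N (vle_subK (val p) u) \o f (val p - u)%R)%VF.
pose F (p : I) : {linear plim M (thicken I e) -> N (val p)} :=
  fdn p \o lim_proj (dn p).
pose gup (p : I) : 'Hom(N (val p), M (val (up p))) := g (val p).
pose G (p : I) : {linear N (val p) -> pcolim M (thicken I e)} :=
  @colim_in _ _ _ M _ (up p) \o gup p.
have [phi phiE] : exists phi : {linear plim M (thicken I e) -> plim N I},
    forall p x, lim_proj p (phi x) = F p x.
  apply: lim_universal => p q pq x.
  rewrite /F /fdn /= !comp_lfunE.
  have pq' := vle_add2r (- u) pq.
  rewrite -(lim_projE (pq' : vle (val (dn p)) (val (dn q)))).
  rewrite (pmor_naturalE f pq') /=.
  have le_pq : vle (val p - u + u) (val q).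
    exact: vle_trans (vle_subK _ _) pq.
  by rewrite !(pm_map_compE _ _ le_pq).
have [psi psiE] : exists psi : {linear pcolim N I -> pcolim M (thicken I e)},
    forall p (x : N (val p)), psi (colim_in x) = G p x.
  apply: colim_universal => p q pq x.
  rewrite /G /gup /= (pmor_naturalE g pq) /=.
  exact: (colim_inE (vle_add2r u pq : vle (val (up p)) (val (up q)))).
have [p0 Ip0] : I !=set0 by case: iI.
pose p : I := SigSub (mem_set Ip0).
apply: (has_rank_comp_le (phi := phi) (psi := psi) _
  (rkP M iT (up p)) (rkP N iI p)).
(* The round trip through [N] at [p] is the structure map of [M] from [p - u] to [p + u], which
   carries one coordinate of [x] to the other. *)
move=> x; rewrite /canonical_map psiE phiE /F /fdn /G /gup /= comp_lfunE.
have u0 := vle_epsvec d e.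
have le_pu : vle (val (dn p)) (val (up p)).
  exact: vle_trans (vle_addr _ u0) (vle_trans (vle_subK _ _) (vle_addr _ u0)).
by rewrite (interleaving_round_trip fg le_pu) (lim_projE le_pu).
Qed.

End Erosion.

Theorem theorem8 (k : fieldType) (R : realType) (d : nat)
    (J : set (set 'rV[R]_d)) (J_int : J `<=` @vinterval R d)
    (J_thick : thickening_closed J) (M N : pmodule k R d) :
  (dE J (rk M) (rk N) <= dI M N)%E.
Proof.
(* It suffices that every interleaving parameter is an erosion parameter: the infimum over the
   larger set is smaller. *)
apply/le_ereal_inf/image_subset => e /= MN I JI.
have iI := J_int _ JI; have iT := J_int _ (J_thick _ e JI).
by split; apply: rk_thicken_le => //; exact: interleaved_sym.
Qed.
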